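(* Let $R$ be a maximal non valuative domain. If $R$ is not integrally closed (in its quotient field), then the following statements hold: (i) $|\mathrm{Max}(R)|\leq 3$. (ii) The set of non-maximal prime ideals of $R$ is linearly ordered by inclusion. (iii) There is at most one maximal ideal of $R$ that does not contain all non-maximal prime ideals of $R$.
   Context: All rings are commutative with identity and are integral domains; $\mathrm{qf}(R)$ denotes the quotient field of $R$, and $\mathrm{Max}(R)$ the set of maximal ideals of $R$. An overring of $R$ is a subring of $\mathrm{qf}(R)$ containing $R$. An integral domain $R$ is a valuative domain if for each nonzero $x\in \mathrm{qf}(R)$, at least one of the extensions $R\subseteq R[x]$ and $R\subseteq R[x^{-1}]$ has no ring strictly between its two ends (equality of the two ends is allowed). An integral domain $R$ is a maximal non valuative domain if $R$ is not a valuative domain but every overring of $R$ properly containing $R$ is a valuative domain. *)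

(* Defs.v *)
From mathcomp Require Import all_boot all_order all_algebra.
From mathcomp Require Import fraction.
From mathcomp Require Import boolp classical_sets functions cardinality.

Set Implicit Arguments.
Unset Strict Implicit.
Unset Printing Implicit Defensive.

Import GRing.Theory.
Local Open Scope classical_set_scope.
Local Open Scope ring_scope.

(* An abstract domain R and its overrings are all handled as sets
   S : set K satisfying [subring S], where K is an ambient field;
   for R itself, K := {fraction R} and S := canon R. *)
Definition subring (K : fieldType) (S : set K) : Prop :=
  subring_closed (mem S).

Definition quot_field (K : fieldType) (S : set K) : set K :=
  [set x | exists a b : K, [/\ S a, S b, b != 0 & x = a / b]].

(* the ring S[x] *)
Definition adjoin (K : fieldType) (S : set K) (x : K) : set K :=
  [set p.[x] | p in [set p : {poly K} | p \is a polyOver (mem S)]].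

(* Equality of the two ends A and B is allowed. *)
Definition no_intermediate_ring (K : fieldType) (A B : set K) : Prop :=
  forall T : set K, subring T -> A `<=` T -> T `<=` B -> T = A \/ T = B.

Definition valuative (K : fieldType) (S : set K) : Prop :=
  forall x : K, quot_field S x -> x != 0 ->
    no_intermediate_ring S (adjoin S x) \/
    no_intermediate_ring S (adjoin S x^-1).

Definition canon (R : idomainType) : set {fraction R} :=
  range (@tofrac R).
Arguments canon : clear implicits.

Definition overring (R : idomainType) (T : set {fraction R}) : Prop :=
  subring T /\ canon R `<=` T.

Definition valuative_domain (R : idomainType) : Prop := valuative (canon R).

Definition maximal_non_valuative_domain (R : idomainType) : Prop :=
  ~ valuative_domain R /\
  forall T : set {fraction R}, overring T -> canon R `<` T -> valuative T.

Definition integrally_closed (R : idomainType) : Prop :=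
  forall x : {fraction R}, integralOver (@tofrac R) x -> canon R x.

(* [idealr_closed I] includes [1 \notin I]: ideals below are proper. *)
Definition prime_ideal (R : idomainType) (P : set R) : Prop :=
  idealr_closed (mem P) /\ prime_idealr_closed (mem P).

Definition maximal_ideal (R : idomainType) (M : set R) : Prop :=
  idealr_closed (mem M) /\
  forall J : set R, idealr_closed (mem J) -> M `<=` J -> J = M.

Definition Max (R : idomainType) : set (set R) :=
  [set M | maximal_ideal M].
Arguments Max : clear implicits.

Definition nonmaximal_primes (R : idomainType) : set (set R) :=
  [set P | prime_ideal P /\ ~ maximal_ideal P].
Arguments nonmaximal_primes : clear implicits.

(* Main.v *)
Require Import Defs.
From mathcomp Require Import all_boot all_order all_algebra.
From mathcomp Require Import fraction generic_quotient.
From mathcomp Require Import boolp classical_sets functions cardinality.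

Set Implicit Arguments.
Unset Strict Implicit.
Unset Printing Implicit Defensive.

Import GRing.Theory.
Local Open Scope classical_set_scope.
Local Open Scope card_scope.
Local Open Scope ring_scope.

(* Let S be the integral closure of R in its fraction field: it is a proper
   overring of R, hence valuative. If S[x] is minimal over S, then either x is in S
   or S[x] = S[x^2], so x is a root of a polynomial over S with a coefficient 1;
   as S is integrally closed, x or x^-1 then lies in each localization of S at a
   prime. With this, minimality of S[b^-1] over S forces b to lie in at most one
   prime of S. Finally, if a + b = 1, then S[a/b] = S[b^-1] and S[b/a] = S[a^-1],
   so a or b lies in at most one prime of S. Each of the three claims fails only if
   R (or S, for the second one) contains such a pair a, b with both elements in two
   primes of S: these primes come from lying over, and the pair from comaximality of
   the ideals involved. *)

(** * Subrings of a field and simple extensions [S[x]] *)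

Section Subring.
Variables (K : fieldType) (S : set K) (ringS : subring S).

Lemma subring1 : S 1.
Proof. by have [/set_mem] := ringS. Qed.

Lemma subringB x y : S x -> S y -> S (x - y).
Proof. by have [_ SB _] := ringS => Sx Sy; apply/set_mem/SB; apply/mem_set. Qed.

Lemma subringM x y : S x -> S y -> S (x * y).
Proof. by have [_ _ SM] := ringS => Sx Sy; apply/set_mem/SM; apply/mem_set. Qed.

Lemma subring0 : S 0.
Proof. by rewrite -(subrr 1); apply: subringB; exact: subring1. Qed.

Lemma subringN x : S x -> S (- x).
Proof. by move=> Sx; rewrite -sub0r; apply: subringB => //; exact: subring0. Qed.

Lemma subringD x y : S x -> S y -> S (x + y).
Proof. by move=> Sx Sy; rewrite -(opprK y); apply: subringB => //; exact: subringN. Qed.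

Lemma subringX x n : S x -> S (x ^+ n).
Proof.
move=> Sx; elim: n => [|n IHn]; first by rewrite expr0; exact: subring1.
by rewrite exprS; exact: subringM.
Qed.

Lemma subring_sum (I : Type) (r : seq I) (P : pred I) (F : I -> K) :
  (forall i, P i -> S (F i)) -> S (\sum_(i <- r | P i) F i).
Proof.
by move=> SF; apply: (big_ind S) => //; [exact: subring0 | exact: subringD].
Qed.

Lemma polyOver_subringP (p : {poly K}) :
  reflect (forall i, S p`_i) (p \is a polyOver (mem S)).
Proof.
apply: (iffP (all_nthP 0)) => Sp i; last by move=> _; apply/mem_set/Sp.
case: (ltnP i (size p)) => [ip|pi]; first exact/set_mem/Sp.
by rewrite nth_default //; exact: subring0.
Qed.

Lemma sub_adjoin x : S `<=` adjoin S x.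
Proof.
move=> s Ss; exists s%:P; last by rewrite hornerC.
by apply/polyOver_subringP => i; rewrite coefC; case: eqP => // _; exact: subring0.
Qed.

Lemma adjoin_gen x : adjoin S x x.
Proof.
exists 'X; last by rewrite hornerX.
by apply/polyOver_subringP => i; rewrite coefX; case: eqP => _;
  [exact: subring1 | exact: subring0].
Qed.

Lemma adjoin_subring x : subring (adjoin S x).
Proof.
split; first exact/mem_set/sub_adjoin/subring1.
- move=> _ _ /set_mem[p /polyOver_subringP Sp <-] /set_mem[q /polyOver_subringP Sq <-].
  apply/mem_set; exists (p - q); last by rewrite hornerD hornerN.
  by apply/polyOver_subringP => i; rewrite coefB; apply: subringB.
- move=> _ _ /set_mem[p /polyOver_subringP Sp <-] /set_mem[q /polyOver_subringP Sq <-].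
  apply/mem_set; exists (p * q); last by rewrite hornerM.
  apply/polyOver_subringP => i; rewrite coefM.
  by apply: subring_sum => j _; apply: subringM.
Qed.
End Subring.

Lemma adjoin_min (K : fieldType) (S T : set K) x :
  subring S -> subring T -> S `<=` T -> T x -> adjoin S x `<=` T.
Proof.
move=> ringS ringT ST Tx _ [p /(polyOver_subringP ringS) Sp <-].
rewrite horner_coef; apply: subring_sum => // i _.
by apply: subringM => //; [exact/ST/Sp | exact: subringX].
Qed.

(** * Ideals, primes and integral closedness for subrings of a field *)

Definition ideal_of (K : fieldType) (S I : set K) : Prop :=
  [/\ I `<=` S, I 0, forall x y, I x -> I y -> I (x + y)
    & forall s x, S s -> I x -> I (s * x)].

Definition prime_of (K : fieldType) (S P : set K) : Prop :=
  [/\ ideal_of S P, ~ P 1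
    & forall x y, S x -> S y -> P (x * y) -> P x \/ P y].

(** Closedness is required in all of [K], through monic polynomials with coefficients in [S],
    because [S] is a set and not a ring type. *)
Definition integrally_closed_in_field (K : fieldType) (S : set K) : Prop :=
  forall (p : {poly K}) x,
    p \is monic -> p \is a polyOver (mem S) -> root p x -> S x.

(* At each prime of S, either e or 1 - e is invertible, so x or x^-1 lies in the
   localization: S is a Pruefer domain. *)
Definition locally_comparable (K : fieldType) (S : set K) : Prop :=
  forall x, x != 0 -> exists e, [/\ S e, S (e * x) & S ((1 - e) / x)].

(** * Roots of polynomials over an integrally closed subring *)

Section IntegrallyClosed.
Variables (K : fieldType) (S : set K) (ringS : subring S).
Hypothesis icS : integrally_closed_in_field S.

(** Multiplying the equation of [x] by the [n]-th power of its leading coefficient [a] gives a monic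
    equation of [a * x]. *)
Lemma lead_mul_integral (p : {poly K}) x n :
  size p = n.+2 -> p \is a polyOver (mem S) -> root p x -> S (p`_n.+1 * x).
Proof.
move=> sp /(polyOver_subringP ringS) Sp /rootP px0.
set a := p`_n.+1.
pose r := \poly_(i < n.+1) (p`_i * a ^+ (n - i)).
apply: (icS (p := 'X^(n.+1) + r)).
- by rewrite monicE lead_coefDl ?lead_coefXn // size_polyXn ltnS size_poly.
- apply/(polyOver_subringP ringS) => i; rewrite coefD coefXn coef_poly.
  apply: subringD => //.
    by case: eqP => _; [exact: subring1 | exact: subring0].
  case: ifP => _; last exact: subring0.
  by apply: subringM; [|exact: Sp|apply: subringX => //; exact: Sp].
apply/rootP; rewrite hornerD hornerXn horner_poly.
transitivity (a ^+ n * p.[x]); last by rewrite px0 mulr0.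
rewrite horner_coef sp [in RHS]big_ord_recr /= mulrDr addrC; congr (_ + _).
  rewrite mulr_sumr; apply: eq_bigr => i _; rewrite exprMn.
  have -> : a ^+ n = a ^+ (n - i) * a ^+ i by rewrite -exprD subnK // -ltnS.
  by rewrite !mulrA; congr (_ * _); rewrite -mulrA mulrC.
by rewrite exprMn [in LHS]exprSr -/a mulrA.
Qed.

(** Induction on the size: [a * x] lies in [S] for the leading coefficient [a], so the top term can
    be absorbed into the next coefficient. Undoing these changes writes each coefficient of [p] as
    [b - c * x]; this is meant for a coefficient equal to 1. *)
Lemma coef_root_split (p : {poly K}) x j :
  p \is a polyOver (mem S) -> root p x ->
  exists b c, [/\ S b, S c, S (b * x), S (c * x) & p`_j = b - c * x].
Proof.
have [n] := ubnP (size p); elim: n p j => // n IHn p j; rewrite ltnS => sp Sp px0.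
have S0 := subring0 ringS.
case sz: (size p) => [|[|m]].
- exists 0, 0; rewrite mul0r subr0; split=> //.
  by rewrite nth_default ?sz.
- have /size_poly1P[c c0 pc] : size p == 1 by rewrite sz.
  by move: px0; rewrite pc rootC (negPf c0).
have Sax := lead_mul_integral sz Sp px0.
set a := p`_m.+1 in Sax.
have Sp' := polyOver_subringP ringS _ Sp.
have S1 := subring1 ringS.
pose d i : K := (i == m)%:R * a.
have Sd i : S (d i) by rewrite /d; case: eqP => _; rewrite ?mul1r ?mul0r //; exact: Sp'.
have Sdx i : S (d i * x) by rewrite /d; case: eqP => _; rewrite ?mul1r ?mul0r.
case: (ltngtP j m.+1) => [jm|jm|->]; last first.
- by exists a, 0; rewrite mul0r subr0; split => //; exact: Sp'.
- by exists 0, 0; rewrite !mul0r subr0 nth_default ?sz.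
pose q : {poly K} := \poly_(i < m.+1) (p`_i + d i * x).
have [] := IHn q j.
- by rewrite (leq_ltn_trans (size_poly _ _)) // -sz.
- apply/(polyOver_subringP ringS) => i; rewrite coef_poly.
  by case: ifP => // _; apply: subringD.
- apply/rootP; rewrite -(rootP px0) horner_poly [in RHS]horner_coef sz.
  rewrite [in RHS]big_ord_recr /=.
  under eq_bigr do rewrite mulrDl.
  rewrite big_split /=; congr (_ + _).
  rewrite (bigD1 ord_max) //= big1 => [|i ne_im].
    by rewrite /d eqxx mul1r addr0 -mulrA -exprS.
  by rewrite /d -(inj_eq val_inj) /= in ne_im *; rewrite (negPf ne_im) !mul0r.
move=> b [c [Sb Sc Sbx Scx]]; rewrite coef_poly jm => pE.
exists b, (c + d j); split => //; rewrite ?mulrDl; try exact: subringD.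
by rewrite opprD addrA -pE addrK.
Qed.

(* S[x] = S[x^2] makes x a root of some X - g(X^2), whose linear coefficient is 1. *)
Lemma minimal_adjoin_comparable x :
  no_intermediate_ring S (adjoin S x) ->
  exists e, [/\ S e, S (e * x) & S ((1 - e) / x)].
Proof.
have [->|x0] := eqVneq x 0.
  by exists 0; rewrite mulr0 subr0 invr0 mulr0; split; exact: subring0.
have S1 := subring1 ringS; have S0 := subring0 ringS.
move=> /(_ (adjoin S (x ^+ 2)))[].
- exact: adjoin_subring.
- exact: sub_adjoin.
- apply: adjoin_min => //; [exact: adjoin_subring|exact: sub_adjoin|].
  by apply: subringX; [exact: adjoin_subring | exact: adjoin_gen].
(* If [S[x^2] = S], then [x] is integral over [S], hence in [S], and [e = 1] works. *)
- move=> SE; have Sx2 : S (x ^+ 2) by rewrite -SE; exact: adjoin_gen.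
  exists 1; rewrite mul1r subrr mul0r; split => //.
  apply: (icS (p := 'X^2 - (x ^+ 2)%:P)).
  + by rewrite monicE lead_coefDl ?lead_coefXn // size_polyXn size_polyN size_polyC; case: eqP.
  + apply/(polyOver_subringP ringS) => i; rewrite coefB coefXn coefC.
    by apply: subringB => //; case: eqP.
  + by apply/rootP; rewrite hornerD hornerN hornerXn hornerC subrr.
move=> SE; have := @adjoin_gen _ _ ringS x; rewrite -SE => -[g /(polyOver_subringP ringS) Sg gx].
have [] := @coef_root_split ('X - (g \Po 'X^2)) x 1.
- apply/(polyOver_subringP ringS) => i; rewrite coefB coefX coef_comp_poly_Xn //.
  by apply: subringB => //; [case: eqP | case: ifP].
- by apply/rootP; rewrite hornerD hornerN hornerX horner_comp hornerXn gx subrr.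
move=> b [c [Sb Sc Sbx Scx]]; rewrite coefB coefX coef_comp_poly_Xn //= subr0 => bE.
have {}bE : 1 = b - c * x := bE.
(* As [1 = b - c * x], the choice [e = b] makes [(1 - e) / x] equal to [- c]. *)
exists b; split => //; rewrite bE addrAC subrr add0r mulNr mulfK //.
exact: subringN.
Qed.

Lemma valuative_locally_comparable :
  valuative S -> (forall x, quot_field S x) -> locally_comparable S.
Proof.
move=> valS qS x x0; have [|/minimal_adjoin_comparable[e [Se Sex Se1x]]] := valS x (qS x) x0.
  exact: minimal_adjoin_comparable.
(* An [e] for [x^-1] gives [1 - e] for [x]. *)
exists (1 - e); rewrite subKr.
by split=> //; [apply: subringB => //; exact: subring1 | rewrite invrK in Se1x].
Qed.

End IntegrallyClosed.

(** * Primes of [S] and minimal extensions [S[b^-1]] *)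

Section Primes.
Variables (K : fieldType) (S : set K) (ringS : subring S).

Lemma primeM_notin (P : set K) x y :
  prime_of S P -> S x -> S y -> ~ P x -> ~ P y -> ~ P (x * y).
Proof. by move=> [_ _ PM] Sx Sy nPx nPy /PM[]. Qed.

(* The elements of S[b^-1] that lie in the localization at P form an intermediate
   ring, and b^-1 is not one of them. *)
Lemma minimal_localization (P : set K) b y s :
  no_intermediate_ring S (adjoin S b^-1) -> prime_of S P -> P b -> b != 0 ->
  adjoin S b^-1 y -> S s -> ~ P s -> S (s * y) -> S y.
Proof.
move=> minb primeP Pb b0 By Ss nPs Ssy.
have [[PS P0 PD PM] P1 _] := primeP.
pose T := adjoin S b^-1 `&` [set z | exists t, [/\ S t, ~ P t & S (t * z)]].
have ringB := adjoin_subring ringS b^-1.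
have [] := minb T.
- split.
  + apply/mem_set; split; first exact: subring1.
    by exists 1; rewrite mulr1; split => //; exact: subring1.
  + move=> u v /set_mem[Bu [t [St nPt Stu]]] /set_mem[Bv [t' [St' nPt' Stv]]].
    apply/mem_set; split; first exact: subringB.
    exists (t * t'); split; [exact: subringM | exact: primeM_notin | ].
    rewrite mulrBr; apply: subringB => //; last by rewrite -mulrA; exact: subringM.
    by rewrite mulrAC; exact: subringM.
  + move=> u v /set_mem[Bu [t [St nPt Stu]]] /set_mem[Bv [t' [St' nPt' Stv]]].
    apply/mem_set; split; first exact: subringM.
    exists (t * t'); split; [exact: subringM | exact: primeM_notin | ].
    by rewrite mulrACA; exact: subringM.
- move=> u Su; split; first exact: sub_adjoin.
  by exists 1; rewrite mul1r; split => //; exact: subring1.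
- by move=> u [].
- by move=> <-; split => //; exists s.
move=> TE; have [_ [t [St nPt Stb]]] : T b^-1 by rewrite TE; exact: adjoin_gen.
by case: nPt; rewrite -(divfK b0 t); exact: PM.
Qed.

Hypothesis compS : locally_comparable S.

(** Take [c] in [Q] but not in [P], and [e] from comparability of [c / b]. If [e] is not in [Q],
    minimality puts [c / b] in [S], hence [c] in [P]. Otherwise it puts [(1 - e) / c] in [S], so [Q]
    contains [1 - e] as well as [e]. *)
Lemma prime_sub_of_minimal (P Q : set K) b :
  no_intermediate_ring S (adjoin S b^-1) -> prime_of S P -> prime_of S Q ->
  b != 0 -> P b -> Q b -> Q `<=` P.
Proof.
move=> minb primeP primeQ b0 Pb Qb c Qc; apply: contrapT => nPc.
have [[PS P0 PD PM] P1 _] := primeP; have [[QS Q0 QD QM] Q1 _] := primeQ.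
have Sc := QS _ Qc.
have c0 : c != 0 by apply/eqP => cE; apply: nPc; rewrite cE.
have ringB := adjoin_subring ringS b^-1.
have Bdiv u : S u -> adjoin S b^-1 (u / b).
  by move=> Su; apply: subringM => //; [exact: sub_adjoin | exact: adjoin_gen].
have [|e [Se Secb Sebc]] := compS (x := c / b); first by rewrite mulf_neq0 ?invr_eq0.
have [Qe|nQe] := pselect (Q e); last first.
  have Scb := minimal_localization minb primeQ Qb b0 (Bdiv _ Sc) Se nQe Secb.
  by apply: nPc; rewrite -(divfK b0 c); exact: PM.
have Se1 : S (1 - e) by apply: subringB => //; exact: subring1.
suff Sy : S ((1 - e) / c).
  have Qe1 : Q (1 - e) by rewrite -(divfK c0 (1 - e)); exact: QM.
  by apply: Q1; rewrite -(subrK e 1); exact: QD.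
have yE : (1 - e) / c = (1 - e) / (c / b) / b by rewrite invf_div mulrA mulrAC mulfK.
apply: (minimal_localization minb primeP Pb b0 _ Sc nPc); first by rewrite yE; exact: Bdiv.
by rewrite mulrC divfK.
Qed.

(** At most one prime is meant: units, which lie in none, qualify. *)
Definition in_one_prime (b : K) : Prop :=
  forall P Q : set K, prime_of S P -> prime_of S Q -> P b -> Q b -> P = Q.

Lemma in_one_prime_of_minimal b :
  no_intermediate_ring S (adjoin S b^-1) -> b != 0 -> in_one_prime b.
Proof.
move=> minb b0 P Q pP pQ Pb Qb; apply/seteqP; split;
  exact: (prime_sub_of_minimal minb).
Qed.

(* If a + b = 1 then S[a / b] = S[b^-1] and S[b / a] = S[a^-1]. *)
Lemma valuative_comaximal_in_one_prime a b :
  valuative S -> quot_field S (a / b) ->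
  a != 0 -> b != 0 -> a + b = 1 -> in_one_prime a \/ in_one_prime b.
Proof.
have divE c d : d != 0 -> c + d = 1 -> adjoin S (c / d) = adjoin S d^-1.
  move=> d0 cdE; have ringc := adjoin_subring ringS (c / d).
  have ringd := adjoin_subring ringS d^-1.
  have -> : c / d = d^-1 - 1 by rewrite -(addrK d c) cdE mulrBl mul1r divff.
  apply/seteqP; split; apply: adjoin_min => //; try exact: adjoin_subring;
    try exact: sub_adjoin.
  - by apply: subringB => //; [exact: adjoin_gen | exact: subring1].
  - rewrite -[X in adjoin _ _ X](subrK 1).
    have ringA := adjoin_subring ringS (d^-1 - 1).
    by apply: subringD => //; [exact: adjoin_gen | exact: subring1].
move=> valS qab a0 b0 abE.
have [||] := valS _ qab; first by rewrite mulf_neq0 ?invr_eq0.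
- by rewrite divE // => minb; right; exact: in_one_prime_of_minimal.
- by rewrite invf_div divE 1?addrC // => mina; left; exact: in_one_prime_of_minimal.
Qed.

(** Take [p] in [P] only, [q] in [Q] only, and [e] from comparability of [p / q]. Then [(1 - e) * q]
    lies in [P] and [e * p] in [Q], so [1 - e] is in [P] and [e] in [Q]. *)
Lemma incomparable_primes_comaximal (P Q : set K) :
  prime_of S P -> prime_of S Q -> ~ P `<=` Q -> ~ Q `<=` P ->
  exists2 a, P a & Q (1 - a).
Proof.
move=> [[PS P0 PD PM] P1 PP] [[QS Q0 QD QM] Q1 QP].
move=> /existsNP[p /not_implyP[Pp nQp]] /existsNP[q /not_implyP[Qq nPq]].
have p0 : p != 0 by apply/eqP => pE; apply: nQp; rewrite pE.
have q0 : q != 0 by apply/eqP => qE; apply: nPq; rewrite qE.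
have Sp := PS _ Pp; have Sq := QS _ Qq.
have [|e [Se Sepq Seqp]] := compS (x := p / q); first by rewrite mulf_neq0 ?invr_eq0.
have Se1 : S (1 - e) by apply: subringB => //; exact: subring1.
exists (1 - e).
- suff [|/nPq] : P (1 - e) \/ P q by [].
  apply: PP => //; have -> : (1 - e) * q = (1 - e) / (p / q) * p.
    by rewrite invf_div mulrA divfK.
  exact: PM.
- rewrite subKr; suff [|/nQp] : Q e \/ Q p by [].
  by apply: QP => //; rewrite -(divfK q0 (e * p)); apply: QM; rewrite // -mulrA.
Qed.

End Primes.

(** * Lifting ideals to primes of the integral closure *)

Section Lifting.
Variables (R : comNzRingType) (K : fieldType) (f : {rmorphism R -> K}).

Definition integral_closure : set K := [set x | integralOver f x].

Let S := integral_closure.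

Lemma integral_closure_subring : subring S.
Proof.
split; first exact/mem_set/integral1.
- by move=> x y /set_mem Sx /set_mem Sy; apply/mem_set/integral_sub.
- by move=> x y /set_mem Sx /set_mem Sy; apply/mem_set/integral_mul.
Qed.

Lemma integral_closure_id r : S (f r).
Proof. exact: integral_id. Qed.

Lemma integral_closure_integrally_closed : integrally_closed_in_field S.
Proof.
move=> p x monp /(polyOver_subringP integral_closure_subring) Sp px0.
by apply: (integral_root_monic monp px0); apply/integral_poly.
Qed.

(* An ideal Q of S containing I and maximal among those avoiding W is prime. If f j
   were not in Q, then q + f j * s = f w with q in Q and w in W; multiplying an
   integral equation of degree n of s by f j ^+ n gives an element of Q that is
   the image of w ^+ n modulo J, hence of an element of W. *)
Lemma integral_prime_lift (I : set K) (J W : set R) :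
  ideal_of S I ->
  (forall j r, J j -> J (j * r)) -> J 0 ->
  (forall j k, J j -> J k -> J (j + k)) ->
  W 1 -> (forall v w, W v -> W w -> W (v * w)) ->
  (forall w j, W w -> J j -> W (w + j)) ->
  (forall w, W w -> ~ I (f w)) ->
  exists Q, [/\ prime_of S Q, I `<=` Q, forall j, J j -> Q (f j)
    & forall w, W w -> ~ Q (f w)].
Proof.
move=> idI JM J0 JD W1 WM WJ IW.
have ringS := integral_closure_subring.
(* The condition is on the union of [I] and [A], so that it also holds for the empty chain, whose
   union is empty. *)
have [A [[idQ QW] Amax]] : exists A : set K,
    (ideal_of S (I `|` A) /\ forall w, W w -> ~ (I `|` A) (f w)) /\
    forall B, A `<` B -> ~ (ideal_of S (I `|` B) /\ forall w, W w -> ~ (I `|` B) (f w)).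
  apply: (Zorn_bigcup (P := fun A =>
    ideal_of S (I `|` A) /\ forall w, W w -> ~ (I `|` A) (f w))).
  move=> F FP Ftot; have [IS I0 ID IM] := idI; split; last first.
    by move=> w Ww [/(IW _ Ww)//|[X FX Xw]]; have [_ /(_ w Ww)] := FP _ FX; apply; right.
  split; first 1 last.
  - by left.
  - have memF X x : F X -> (I `|` X) x -> (I `|` \bigcup_(Y in F) Y) x.
      by move=> FX [|Xx]; [left | right; exists X].
    move=> x y [Ix|[X FX Xx]] [Iy|[Y FY Yy]].
    + by left; exact: ID.
    + by apply: (memF Y) => //; have [[_ _ D _] _] := FP _ FY; apply: D; [left|right].
    + by apply: (memF X) => //; have [[_ _ D _] _] := FP _ FX; apply: D; [right|left].
    + have [XY|YX] := Ftot _ _ FX FY.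
      * by apply: (memF Y) => //; have [[_ _ D _] _] := FP _ FY; apply: D; right => //; exact: XY.
      * by apply: (memF X) => //; have [[_ _ D _] _] := FP _ FX; apply: D; right => //; exact: YX.
  - move=> s x Ss [Ix|[X FX Xx]]; first by left; exact: IM.
    have [[_ _ _ M] _] := FP _ FX; have [|?|?] := M s x Ss; first by right.
      by left.
    by right; exists X.
  - by move=> x [/IS//|[X FX Xx]]; have [[XS _ _ _] _] := FP _ FX; apply: XS; right.
set Q := I `|` A in idQ QW.
have [QS Q0 QD QM] := idQ.
(* By maximality, [Q + x S] meets the image of [W] when [x] is outside [Q]. *)
have Qmax x : S x -> ~ Q x -> exists q s w, [/\ Q q, S s, W w & q + x * s = f w].
  move=> Sx nQx; apply: contrapT => nW.
  pose B : set K := [set z | exists q s, [/\ Q q, S s & z = q + x * s]].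
  have QB : Q `<=` B by move=> q Qq; exists q, 0; rewrite mulr0 addr0; split => //; exact: subring0.
  have IBE : I `|` B = B by apply/setUidr => z Iz; apply: QB; left.
  apply: (Amax B); last rewrite IBE; split.
  - by move=> z Az; apply: QB; right.
  - move=> BA; apply: nQx; right; apply: BA; exists 0, 1; rewrite add0r mulr1.
    by split => //; exact: subring1.
  - split.
    + by move=> _ [q [s [Qq Ss ->]]]; apply: subringD => //; [exact: QS | exact: subringM].
    + exact: QB.
    + move=> _ _ [q [s [Qq Ss ->]]] [q' [s' [Qq' Ss' ->]]]; exists (q + q'), (s + s').
      by split; [exact: QD | exact: subringD | rewrite addrACA mulrDr].
    + move=> t _ St [q [s [Qq Ss ->]]]; exists (t * q), (t * s).
      by split; [exact: QM | exact: subringM | rewrite mulrDr mulrCA].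
  - by move=> w Ww [q [s [Qq Ss wE]]]; apply: nW; exists q, s, w.
exists Q; split => //; [split => // | by move=> z Iz; left |].
- by rewrite -(rmorph1 f); exact: QW.
- move=> x y Sx Sy Qxy; apply: contrapT => /not_orP[nQx nQy].
  have [q [s [w [Qq Ss Ww wE]]]] := Qmax _ Sx nQx.
  have [q' [s' [w' [Qq' Ss' Ww' wE']]]] := Qmax _ Sy nQy.
  apply: (QW _ (WM _ _ Ww Ww')); rewrite rmorphM -wE -wE' mulrDr.
  apply: (QD); first by apply: (QM) => //; rewrite wE; exact: integral_closure_id.
  rewrite mulrDl; apply: (QD).
    by rewrite mulrC; apply: (QM) => //; exact: subringM.
  by rewrite mulrACA mulrC; apply: (QM) => //; exact: subringM.
- move=> j Jj; apply: contrapT => nQj.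
  have [q [s [w [Qq [p monp /rootP ps0] Ww wE]]]] := Qmax _ (integral_closure_id j) nQj.
  have [n sp] : exists n, size p = n.+1.
    by exists (size p).-1; rewrite prednK // size_poly_gt0 monic_neq0.
  have JX k : J (j ^+ k.+1) by rewrite exprS; exact: JM.
  (* [r] is the homogenized integral equation of [s] at [(w, j)]. Modulo [J] it is [w ^+ n]. Modulo
     [Q], where [f w] agrees with [f j * s], its image is [f j ^+ n] times the equation at [s],
     which vanishes. *)
  pose r := \sum_(i < n.+1) p`_i * j ^+ (n - i) * w ^+ i.
  have Wr : W r.
    rewrite /r big_ord_recr /= subnn expr0 mulr1.
    have -> : p`_n = 1 by have := monicP monp; rewrite lead_coefE sp.
    rewrite mul1r addrC; apply: WJ.
      by elim: (n) => [|k IHk]; rewrite ?expr0 // exprS; exact: WM.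
    apply: (big_ind J) => // i _.
    rewrite -(subnSK (ltn_ord i)) mulrAC mulrC; exact: JM.
  apply: (QW _ Wr).
  have SwX i : S (f w ^+ i) by apply: subringX => //; exact: integral_closure_id.
  set x := f j * s.
  have Sx : S x by apply: subringM => //; [exact: integral_closure_id | exists p => //; apply/rootP].
  have QX i : Q (f w ^+ i - x ^+ i).
    elim: i => [|i IHi]; first by rewrite !expr0 subrr.
    have -> : f w ^+ i.+1 - x ^+ i.+1 =
        f w ^+ i * q + x * (f w ^+ i - x ^+ i).
      by rewrite !exprS mulrBr addrA -wE -/x; congr (_ - _); rewrite mulrDl [q * _]mulrC.
    by apply: (QD); apply: (QM).
  suff -> : f r = \sum_(i < n.+1)
      f (p`_i * j ^+ (n - i)) * (f w ^+ i - x ^+ i).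
    by apply: (big_ind Q) => // i _; apply: (QM) => //; exact: integral_closure_id.
  under [RHS]eq_bigr do rewrite mulrBr.
  rewrite sumrB /r rmorph_sum /=.
  under eq_bigr do rewrite rmorphM rmorphXn.
  suff -> : \sum_(i < n.+1) f (p`_i * j ^+ (n - i)) * x ^+ i = 0 by rewrite subr0.
  transitivity (f j ^+ n * (map_poly (f) p).[s]); last by rewrite ps0 mulr0.
  rewrite horner_coef size_map_poly_id0 ?sp; last by rewrite (monicP monp) rmorph1 oner_eq0.
  rewrite mulr_sumr; apply: eq_bigr => i _.
  have -> : f j ^+ n = f j ^+ (n - i) * f j ^+ i by rewrite -exprD subnK // -ltnS.
  rewrite rmorphM rmorphXn coef_map /x exprMn !mulrA; congr (_ * _).
  by rewrite -mulrA mulrC.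
Qed.

End Lifting.

(** * Comaximal and maximal ideals of [R] *)

Section RingIdeals.
Variable R : idomainType.
Implicit Types I J L M N P : set R.

Lemma idealr_closedP I :
  idealr_closed (mem I) <->
  [/\ I 0, ~ I 1, forall x y, I x -> I y -> I (x + y) & forall a x, I x -> I (a * x)].
Proof.
split=> [[/set_mem I0 /negP I1 Ilin]|[I0 I1 ID IM]].
  have IL a u v : I u -> I v -> I (a * u + v).
    by move=> Iu Iv; apply/set_mem/Ilin; apply/mem_set.
  split => // [/mem_set//|x y Ix Iy|a x Ix]; first by rewrite -[x]mul1r; exact: IL.
  by rewrite -[a * x]addr0; exact: IL.
split; [exact/mem_set | by apply/negP => /set_mem |].
by move=> a u v /set_mem Iu /set_mem Iv; apply/mem_set/ID => //; exact: IM.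
Qed.

Definition comaximal I J : Prop := exists2 a, I a & J (1 - a).

Lemma comaximal_sym I J : comaximal I J -> comaximal J I.
Proof. by move=> [a Ia Ja]; exists (1 - a); rewrite ?subKr. Qed.

(** With [1 - a] in [J] and [1 - b] in [L], the product [(1 - a) * (1 - b)] lies in both and differs
    from 1 by an element of [I]. *)
Lemma comaximalI I J L :
  (forall x y, I x -> I y -> I (x + y)) -> (forall a x, I x -> I (a * x)) ->
  (forall a x, J x -> J (a * x)) -> (forall a x, L x -> L (a * x)) ->
  comaximal I J -> comaximal I L -> comaximal I (J `&` L).
Proof.
move=> ID IM JM LM [a Ia Ja] [b Ib Lb]; exists (a + (1 - a) * b).
  by apply: ID => //; exact: IM.
have -> : 1 - (a + (1 - a) * b) = (1 - a) * (1 - b).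
  by rewrite mulrBr mulr1 opprD addrA.
by split; [rewrite mulrC; exact: JM | exact: LM].
Qed.

Lemma maximal_comaximal J M :
  (forall x y, J x -> J y -> J (x + y)) -> (forall a x, J x -> J (a * x)) ->
  maximal_ideal M -> ~ J `<=` M -> comaximal J M.
Proof.
move=> JD JM [/idealr_closedP[M0 M1 MD MM] maxM] /existsNP[j /not_implyP[Jj nMj]].
apply: contrapT => ncom; apply: nMj.
(* The ideal generated by [j] and [M] is proper since [J] and [M] are not comaximal; by maximality
   it is [M]. *)
pose L : set R := [set z | exists r m, M m /\ z = r * j + m].
suff -> : M = L by exists 1, 0; rewrite mul1r addr0.
apply/esym/maxM; last by move=> m Mm; exists 0, m; rewrite mul0r add0r.
apply/idealr_closedP; split.
- by exists 0, 0; rewrite mul0r addr0.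
- move=> [r [m [Mm rmE]]]; apply: ncom; exists (r * j); first exact: JM.
  by rewrite rmE addrC addKr.
- move=> _ _ [r [m [Mm ->]]] [r' [m' [Mm' ->]]]; exists (r + r'), (m + m').
  by split; [exact: MD | rewrite addrACA mulrDl].
- move=> a _ [r [m [Mm ->]]]; exists (a * r), (a * m).
  by split; [exact: MM | rewrite mulrDr mulrA].
Qed.

Lemma maximal_sub_eq M N : maximal_ideal M -> maximal_ideal N -> M `<=` N -> M = N.
Proof. by move=> [_ maxM] [idN _] MN; rewrite (maxM N). Qed.

Lemma maximal_neq_comaximal M N :
  maximal_ideal M -> maximal_ideal N -> M <> N -> comaximal M N.
Proof.
move=> maxM maxN MN; have [/idealr_closedP[_ _ MD MM] _] := maxM.
by apply: maximal_comaximal => // sMN; apply: MN; exact: maximal_sub_eq.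
Qed.

End RingIdeals.

(** * Primes of [R] under a valuative integral closure [S] *)

Section ValuativeClosure.
Variables (R : idomainType) (K : fieldType) (f : {rmorphism R -> K}).
Hypothesis f_inj : injective f.
Let S := integral_closure f.
Let ringS : subring S := integral_closure_subring f.
Hypotheses (valS : valuative S) (quotS : forall x, quot_field S x).
Implicit Types I J M N : set R.

Let compS : locally_comparable S.
Proof.
exact: (valuative_locally_comparable ringS
  (@integral_closure_integrally_closed _ _ f) valS quotS).
Qed.

Lemma ideal_zero : ideal_of S [set 0].
Proof.
split => //.
- by move=> _ ->; exact: subring0.
- by move=> x y -> ->; rewrite /= addr0.
- by move=> s x _ ->; rewrite /= mulr0.
Qed.

Lemma fraction_eq0 r : f r = 0 -> r = 0.
Proof. by move=> fr0; apply: f_inj; rewrite fr0 rmorph0. Qed.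

(** Here [W = 1 + J]: an element of [W] mapped into [I] would lie in [J], and then so would 1. *)
Lemma proper_ideal_lift (I : set K) J :
  ideal_of S I -> idealr_closed (mem J) -> (forall r, I (f r) -> J r) ->
  exists Q, [/\ prime_of S Q, I `<=` Q & forall j, J j -> Q (f j)].
Proof.
move=> idI /idealr_closedP[J0 J1 JD JM] IJ.
have [] := @integral_prime_lift _ _ f I J [set w | J (w - 1)] idI.
- by move=> j r Jj; rewrite mulrC; exact: JM.
- exact: J0.
- exact: JD.
- by rewrite /= subrr.
- move=> v w /= Jv Jw; have -> : v * w - 1 = v * (w - 1) + (v - 1).
    by rewrite mulrBr mulr1 addrA subrK.
  by apply: JD => //; exact: JM.
- by move=> w j /= Jw Jj; rewrite addrAC; exact: JD.
- move=> w /= Jw1 /IJ Jw; apply: J1; rewrite -(subKr w 1) -mulN1r.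
  by apply: (JD) => //; exact: JM.
by move=> Q [pQ IQ JQ _]; exists Q.
Qed.

(** Here [W] is the complement of [P], so the prime obtained contracts exactly to [P]. *)
Lemma lying_over (P : set R) : prime_ideal P ->
  exists2 P', prime_of S P' & forall r, P' (f r) <-> P r.
Proof.
move=> [/idealr_closedP[P0 P1 PD PM] primeP].
have [] := @integral_prime_lift _ _ f [set 0] P (~` P) ideal_zero.
- by move=> j r Pj; rewrite mulrC; exact: PM.
- exact: P0.
- exact: PD.
- exact: P1.
- move=> v w nPv nPw Pvw.
  by have /orP[/set_mem|/set_mem] := primeP v w (mem_set Pvw).
- move=> w j nPw Pj Pwj; apply: nPw; rewrite -(addrK j w); apply: PD => //.
  by rewrite -mulN1r; exact: PM.
- by move=> w nPw /fraction_eq0 w0; apply: nPw; rewrite w0.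
move=> P' [pP' _ PP' nPP']; exists P' => // r; split; last exact: PP'.
by move=> P'r; apply: contrapT => /nPP'.
Qed.

(** A proper ideal [J] strictly above [P] lifts to a prime [P''] above [P']; containing the image of
    [J], it differs from [P']. Elements of [P] thus lie in two primes of [S]. *)
Lemma nonmaximal_prime_chain (P : set R) : nonmaximal_primes R P ->
  exists P' P'', [/\ prime_of S P', prime_of S P'', P' `<=` P'', P' <> P''
    & forall r, P' (f r) <-> P r].
Proof.
move=> [primeP nmaxP]; have [P' pP' PP'] := lying_over primeP.
have [J [idJ PJ nJP]] : exists J, [/\ idealr_closed (mem J), P `<=` J & J <> P].
  apply: contrapT => nJ; apply: nmaxP; split; first by case: primeP.
  by move=> J idJ PJ; apply: contrapT => nJP; apply: nJ; exists J.
have [idP' _ _] := pP'.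
have [|P'' [pP'' P'P'' JP'']] := proper_ideal_lift idP' idJ.
  by move=> r /PP'/PJ.
exists P', P''; split => // P'E; apply: nJP; apply/seteqP; split => // j /JP''.
by rewrite -P'E => /PP'.
Qed.

Lemma nonmaximal_prime_not_in_one_prime (P : set R) a :
  nonmaximal_primes R P -> P a -> ~ in_one_prime S (f a).
Proof.
move=> /nonmaximal_prime_chain[P' [P'' [pP' pP'' P'P'' P'nE PP']]] /PP' P'a one.
by apply/P'nE/one => //; exact: P'P''.
Qed.

(** A single prime over both [M] and [N] would contain 1, as distinct maximal ideals are
    comaximal. *)
Lemma maximal_pair_not_in_one_prime M N a :
  maximal_ideal M -> maximal_ideal N -> M <> N -> (M `&` N) a ->
  ~ in_one_prime S (f a).
Proof.
move=> maxM maxN MN [Ma Na] one.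
have lift J : maximal_ideal J -> exists2 Q, prime_of S Q & forall j, J j -> Q (f j).
  move=> [idJ _]; have [] := proper_ideal_lift ideal_zero idJ.
    by move=> r /fraction_eq0 ->; have /idealr_closedP[] := idJ.
  by move=> Q [pQ _ JQ]; exists Q.
have [P pP MP] := lift _ maxM; have [Q pQ NQ] := lift _ maxN.
have PQ := one _ _ pP pQ (MP _ Ma) (NQ _ Na).
have [c Mc Nc] := maximal_neq_comaximal maxM maxN MN.
have [[_ _ D _] Q1 _] := pQ; apply: Q1.
rewrite -(rmorph1 f) -(subrK c 1) rmorphD; apply: D; first exact: NQ.
by rewrite -PQ; exact: MP.
Qed.

Lemma in_one_prime1 : in_one_prime S 1.
Proof. by move=> P Q [_ P1 _] _ /P1. Qed.

Lemma not_comaximal I J :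
  (forall a, I a -> ~ in_one_prime S (f a)) ->
  (forall a, J a -> ~ in_one_prime S (f a)) -> ~ comaximal I J.
Proof.
move=> onI onJ [a Ia Ja].
(* If [a] or [1 - a] is 0, the other is 1, which lies in no prime; the dichotomy below needs both
   nonzero. *)
have [a0|a0] := eqVneq a 0.
  by apply: (onJ _ Ja); rewrite a0 subr0 rmorph1; exact: in_one_prime1.
have [b0|b0] := eqVneq (1 - a) 0.
  by apply: (onI _ Ia); move/subr0_eq: b0 => <-; rewrite rmorph1; exact: in_one_prime1.
have f0 r : r != 0 -> f r != 0 by apply: contra_neq => /fraction_eq0.
have [] := valuative_comaximal_in_one_prime ringS compS valS (quotS _) (f0 _ a0) (f0 _ b0).
- by rewrite -rmorphD addrC subrK rmorph1.
- exact: onI.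
- exact: onJ.
Qed.

(** The comaximal pair is found in [S], where incomparable primes are comaximal: [a] lies in [P']
    and [P''], [1 - a] in [Q'] and [Q'']. *)
Lemma nonmaximal_primes_total :
  total_on (nonmaximal_primes R) (fun P Q : set R => P `<=` Q).
Proof.
move=> P Q nmP nmQ; apply: contrapT => /not_orP[nPQ nQP].
have [P' [P'' [pP' pP'' P'P'' P'nE PP']]] := nonmaximal_prime_chain nmP.
have [Q' [Q'' [pQ' pQ'' Q'Q'' Q'nE QQ']]] := nonmaximal_prime_chain nmQ.
have [||a P'a Q'a] := incomparable_primes_comaximal ringS compS pP' pQ'.
- by move=> sPQ; apply: nPQ => r /PP'/sPQ/QQ'.
- by move=> sQP; apply: nQP => r /QQ'/sQP/PP'.
have [_ P'1 _] := pP'; have [_ Q'1 _] := pQ'.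
have a0 : a != 0 by apply/eqP => aE; apply: Q'1; rewrite -(subr0 1) -[in X in Q' X]aE.
have b0 : 1 - a != 0 by apply/eqP => /subr0_eq aE; apply: P'1; rewrite aE.
have [] := valuative_comaximal_in_one_prime ringS compS valS (quotS _) a0 b0.
- by rewrite addrC subrK.
- by move=> one; apply/P'nE/one => //; exact: P'P''.
- by move=> one; apply/Q'nE/one => //; exact: Q'Q''.
Qed.

Lemma maximal_missing_nonmaximal_unique :
  is_subset1 [set M : set R |
    Max R M /\ ~ (forall P : set R, nonmaximal_primes R P -> P `<=` M)].
Proof.
move=> M N [maxM /existsNP[P /not_implyP[nmP nPM]]].
move=> [maxN /existsNP[Q /not_implyP[nmQ nQN]]]; apply: contrapT => MN.
(* By linearity, the larger of [P] and [Q] is contained in neither [M] nor [N]. *)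
have [L [nmL nLM nLN]] : exists L, [/\ nonmaximal_primes R L, ~ L `<=` M & ~ L `<=` N].
  have [PQ|QP] := nonmaximal_primes_total nmP nmQ.
  - by exists Q; split => // QM; apply: nPM => x /PQ/QM.
  - by exists P; split => // PN; apply: nQN => x /QP/PN.
have [[/idealr_closedP[_ _ LD LM] _] _] := nmL.
have [[/idealr_closedP[_ _ _ MM] _] [/idealr_closedP[_ _ _ NM] _]] := (maxM, maxN).
apply: (@not_comaximal L (M `&` N)).
- by move=> a; exact: nonmaximal_prime_not_in_one_prime.
- by move=> a; exact: maximal_pair_not_in_one_prime.
by apply: comaximalI => //; exact: maximal_comaximal.
Qed.

(** Four distinct maximal ideals split into two pairs with comaximal intersections, while every
    element of either intersection lies in two primes of [S]. *)
Lemma no_four_maximal M1 M2 M3 M4 :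
  Max R M1 -> Max R M2 -> Max R M3 -> Max R M4 ->
  M1 <> M2 -> M1 <> M3 -> M1 <> M4 -> M2 <> M3 -> M2 <> M4 -> M3 <> M4 -> False.
Proof.
move=> max1 max2 max3 max4 n12 n13 n14 n23 n24 n34.
have maxD M : Max R M -> forall x y, M x -> M y -> M (x + y).
  by move=> [/idealr_closedP[]].
have maxM M : Max R M -> forall a x, M x -> M (a * x).
  by move=> [/idealr_closedP[]].
have maxID M N : Max R M -> Max R N ->
    forall x y, (M `&` N) x -> (M `&` N) y -> (M `&` N) (x + y).
  by move=> mM mN x y [Mx Nx] [My Ny]; split; apply: maxD.
apply: (@not_comaximal (M3 `&` M4) (M1 `&` M2)).
- by move=> a; exact: maximal_pair_not_in_one_prime.
- by move=> a; exact: maximal_pair_not_in_one_prime.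
apply: comaximalI; [exact: maxID | | exact: maxM | exact: maxM | |].
- by move=> a x [M3x M4x]; split; apply: maxM.
- apply/comaximal_sym/comaximalI; [exact: maxD | exact: maxM | exact: maxM | exact: maxM | |];
  exact: maximal_neq_comaximal.
- apply/comaximal_sym/comaximalI; [exact: maxD | exact: maxM | exact: maxM | exact: maxM | |];
  exact: maximal_neq_comaximal.
Qed.

Lemma card_Max_le3 : Max R #<= `I_3.
Proof.
have [->|/set0P[M1 max1]] := eqVneq (Max R) set0; first exact: card_ge0.
(* Repetitions among the three ideals let the same bound serve for one or two maximal ideals. *)
have cover M2 M3 : Max R `<=` [set M1; M2; M3] -> Max R #<= `I_3.
  move=> sub; apply: card_le_trans (card_image_le (nth M1 [:: M1; M2; M3]) _).
  apply: subset_card_le => M /sub[[->|->]|->]; [by exists 0%N | by exists 1%N | by exists 2%N].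
have [s1|/existsNP[M2 /not_implyP[max2 n2]]] := pselect (Max R `<=` [set M1; M1; M1]).
  exact: cover s1.
have [s2|/existsNP[M3 /not_implyP[max3 n3]]] := pselect (Max R `<=` [set M1; M2; M2]).
  exact: cover s2.
apply: (cover M2 M3) => M4 max4; apply: contrapT => n4.
apply: (no_four_maximal max1 max2 max3 max4) => E.
- by apply: n2; left; left.
- by apply: n3; left; left.
- by apply: n4; left; left.
- by apply: n3; right.
- by apply: n4; left; right.
- by apply: n4; right.
Qed.

End ValuativeClosure.

(** * The fraction field of [R] and the conclusion *)

Lemma fraction_repr (R : idomainType) (x : {fraction R}) :
  exists n d, d != 0 /\ x = tofrac n / tofrac d.
Proof.
elim/quotW: x => r; have d0 := denom_ratioP r.
exists (frac r).1, (frac r).2; split => //.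
(* The denominator is cleared, and the equality of classes becomes an equivalence of ratios. *)
apply: (canRL (mulfK _)); first by rewrite tofrac_eq0.
rewrite -[LHS]/(FracField.mul _ _) !piE /FracField.mulf.
rewrite !numden_Ratio ?oner_eq0 // mulr1.
apply/eqP; rewrite FracField.equivf_def.
by rewrite !numden_Ratio ?oner_eq0 // ?mulr1 1?mulrC.
Qed.

Theorem theorem2p7 (R : idomainType) :
  maximal_non_valuative_domain R ->
  ~ integrally_closed R ->
  [/\ Max R #<= `I_3,
      total_on (nonmaximal_primes R) (fun P Q : set R => P `<=` Q)
    & is_subset1 [set M : set R |
        Max R M /\ ~ (forall P : set R, nonmaximal_primes R P -> P `<=` M)]].
Proof.
move=> [_ valR] nicR.
have f_inj : injective (@tofrac R) by move=> x y /eqP; rewrite tofrac_eq => /eqP.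
have valS : valuative (integral_closure (@tofrac R)).
  apply: valR.
    by split; [exact: integral_closure_subring | move=> _ [r _ <-]; exact: integral_closure_id].
  (* The overring is proper because some integral element lies outside [R]. *)
  split; first by move=> _ [r _ <-]; exact: integral_closure_id.
  by move=> sub; apply: nicR => x /sub.
have quotS x : quot_field (integral_closure (@tofrac R)) x.
  have [n [d [d0 ->]]] := fraction_repr x.
  by exists (tofrac n), (tofrac d); split => //; rewrite ?tofrac_eq0 //; exact: integral_closure_id.
split.
- exact: card_Max_le3 f_inj valS quotS.
- exact: nonmaximal_primes_total f_inj valS quotS.
- exact: maximal_missing_nonmaximal_unique f_inj valS quotS.
Qed.
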